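(* Let $d,q$ be positive integers, let $i\neq j$ be in $\{1,\ldots,d\}$, and let $$U_i=(\mathbf{0}\,(0,\ldots,a_i,\ldots,0)\,(0,\ldots,b_i,\ldots,0)\,\mathbf{0}),\qquad U_j=(\mathbf{0}\,(0,\ldots,a_j,\ldots,0)\,(0,\ldots,b_j,\ldots,0)\,\mathbf{0})$$ be ground walks in the $i$th and $j$th coordinates of the Hamming graph $H(d,q)$. Then $U_i*U_j\simeq U_j*U_i$, i.e. $U_i$ and $U_j$ commute.
   Context: The Hamming graph $H(d,q)$ has vertex set $\{(x_1,\ldots,x_d): x_i\in S\}$ with $S=\{0,1,\ldots,q-1\}$, and two vertices are adjacent if and only if they differ in exactly one coordinate; $\mathbf{0}=(0,\ldots,0)$. A walk of length $n$ in a graph is a sequence of vertices $(v_0v_1\cdots v_n)$ with $v_i$ adjacent to $v_{i+1}$ for all $0\le i<n$; $*$ denotes concatenation of walks. A ground walk in the $i$th coordinate is a closed walk of length three $U_i=(\mathbf{0}\,(0,\ldots,a_i,\ldots,0)\,(0,\ldots,b_i,\ldots,0)\,\mathbf{0})$, where $a_i,b_i$ are placed in the $i$th coordinate and all other coordinates are $0$ (so $a_i,b_i$ are nonzero and distinct). Two walks are equivalent, written $\simeq$ (homotopic rel endpoints for $\times$-homotopy), if one can be transformed into the other by a finite sequence of the following moves: (1) spider moves: replacing a single interior vertex $v_k$ ($0<k<n$) of a walk by another vertex $v_k'$ such that the result is again a walk (so $v_k'$ is adjacent to both $v_{k-1}$ and $v_{k+1}$); (2) prunes: if $v_i=v_{i+2}$,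 deleting the entries $v_i,v_{i+1}$ from the walk; (3) anti-prunes: the inverse operation of a prune. *)

(* Defs.v *)
From Stdlib Require Import Relation_Operators.
From mathcomp Require Import all_boot.

Set Implicit Arguments.
Unset Strict Implicit.
Unset Printing Implicit Defensive.

(* A walk of length n in the graph (T, e) is given by the sequence of its
   n + 1 vertices; in particular it is never empty. *)
Definition is_walk (T : Type) (e : rel T) (w : seq T) : bool :=
  if w is v0 :: p then path e v0 p else false.

(* Concatenation identifies the last vertex of [w1] with the first one of
   [w2]; it is meaningful only when these two vertices coincide. *)
Definition walk_cat (T : Type) (w1 w2 : seq T) : seq T := w1 ++ behead w2.

Inductive walk_move (T : Type) (e : rel T) : seq T -> seq T -> Prop :=
| Spider (p s : seq T) (x y y' z : T) :
    is_walk e (p ++ [:: x, y, z & s]) ->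
    is_walk e (p ++ [:: x, y', z & s]) ->
    walk_move e (p ++ [:: x, y, z & s]) (p ++ [:: x, y', z & s])
| Prune (p s : seq T) (x y : T) :
    is_walk e (p ++ [:: x, y, x & s]) ->
    walk_move e (p ++ [:: x, y, x & s]) (p ++ x :: s)
| AntiPrune (p s : seq T) (x y : T) :
    is_walk e (p ++ [:: x, y, x & s]) ->
    walk_move e (p ++ x :: s) (p ++ [:: x, y, x & s]).

(* Moves only relate walks, so requiring that [w] is a walk forces [w'] to be
   one, also when the sequence of moves is empty. *)
Definition walk_equiv (T : Type) (e : rel T) (w w' : seq T) : Prop :=
  is_walk e w /\ clos_refl_trans (seq T) (walk_move e) w w'.

Definition hamming_vertex (d q : nat) : finType := {ffun 'I_d -> 'I_q}.

Definition hamming (d q : nat) : rel (hamming_vertex d q) :=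
  fun x y => #|[set k : 'I_d | x k != y k]| == 1.

(* The positivity of [q] provides the symbol 0 of the alphabet 'I_q. *)
Definition origin (d q : nat) (hq : 0 < q) : hamming_vertex d q :=
  [ffun=> Ordinal hq].

Definition axis_vertex (d q : nat) (hq : 0 < q) (i : 'I_d) (a : 'I_q) :
    hamming_vertex d q :=
  [ffun k => if k == i then a else Ordinal hq].

(* That [a] and [b] are nonzero and distinct is a consequence of [U] being a
   walk. *)
Definition ground_walk (d q : nat) (hq : 0 < q) (i : 'I_d)
    (U : seq (hamming_vertex d q)) : Prop :=
  is_walk (@hamming d q) U /\
  exists a b : 'I_q,
    U = [:: origin d hq; axis_vertex hq i a; axis_vertex hq i b; origin d hq].

(* Main.v *)
Require Import Defs.
From Stdlib Require Import Relation_Operators.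
From mathcomp Require Import all_boot.

Set Implicit Arguments.
Unset Strict Implicit.
Unset Printing Implicit Defensive.

(** The two ground walks move along different axes, so together they span a
    copy of a product of two graphs inside the Hamming graph: the vertices
    [plane_vertex hq i j a b], carrying [a] on axis [i] and [b] on axis [j].
    In a product, a horizontal edge followed by a vertical one bounds a square,
    and replacing the corner of the path along that square by the opposite
    corner is a spider move. A horizontal walk followed by a vertical walk is a
    lattice path on the boundary of a rectangle of such squares; sweeping the
    rectangle square by square turns it into the vertical walk followed by the
    horizontal one ([slide_edge] sweeps one strip, [product_walks_commute] the
    whole rectangle). As ground walks are closed, the copies of [Ui] and [Uj]
    on opposite sides of the rectangle are the same walks, so the two boundary
    paths are [Ui * Uj] and [Uj * Ui]. *)

Section Walks.

Variables (T : Type) (e : rel T).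
Implicit Types (p s w : seq T).

Lemma is_walk_cat p x s :
  is_walk e (p ++ x :: s) = is_walk e (rcons p x) && path e x s.
Proof. by case: p => [|v p] //=; rewrite cat_path rcons_path /= andbA. Qed.

Lemma walk_move_is_walk w w' :
  walk_move e w w' -> is_walk e w -> is_walk e w'.
Proof.
case=> // p s x y; rewrite !is_walk_cat /=.
by case/and4P=> -> _ _ ->.
Qed.

Lemma walk_equiv_is_walk w w' : walk_equiv e w w' -> is_walk e w'.
Proof.
case=> Hw Hww'; move: Hw; elim: Hww' => // {w w'}.
- exact: walk_move_is_walk.
- by move=> w1 w2 w3 _ H12 _ H23 /H12 /H23.
Qed.

Lemma walk_equiv_refl w : is_walk e w -> walk_equiv e w w.
Proof. by split=> //; apply: rt_refl. Qed.

Lemma walk_equiv_trans w2 w1 w3 :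
  walk_equiv e w1 w2 -> walk_equiv e w2 w3 -> walk_equiv e w1 w3.
Proof. by move=> [Hw1 H12] [_ H23]; split=> //; apply: rt_trans H12 H23. Qed.

Lemma spider_equiv p s x y y' z :
    e x y' -> e y' z -> is_walk e (p ++ [:: x, y, z & s]) ->
  walk_equiv e (p ++ [:: x, y, z & s]) (p ++ [:: x, y', z & s]).
Proof.
move=> exy' ey'z Hw; split=> //; apply: rt_step; apply: Spider => //.
move: Hw; rewrite !is_walk_cat /= exy' ey'z.
by case/and4P=> -> _ _ ->.
Qed.

End Walks.

Section ProductWalks.

Variables (A B T : Type) (eA : rel A) (eB : rel B) (e : rel T).
Variable f : A -> B -> T.
Hypothesis f_l : forall x x' y, eA x x' -> e (f x y) (f x' y).
Hypothesis f_r : forall x y y', eB y y' -> e (f x y) (f x y').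

(** The surrounding walks [p] and [s] are part of the statement because moves
    act on whole walks: the recursion absorbs into [p] the vertices that the
    edge from [x] to [x'] has already passed. *)
Lemma slide_edge p s x x' y r :
    eA x x' -> path eB y r ->
    is_walk e (p ++ f x y :: map (f x') (y :: r) ++ s) ->
  walk_equiv e (p ++ f x y :: map (f x') (y :: r) ++ s)
               (p ++ map (f x) (y :: r) ++ f x' (last y r) :: s).
Proof.
move=> exx'; elim: r p y => [|y' r IHr] p y /=.
  by move=> _; apply: walk_equiv_refl.
case/andP=> eyy' Hr Hw.
have Hspider := spider_equiv (f_r x eyy') (f_l y' exx') Hw.
apply: (walk_equiv_trans Hspider).
have := walk_equiv_is_walk Hspider.
by rewrite -!(cat_rcons (f x y)); apply: IHr.
Qed.

(** Each edge of the horizontal walk is pushed across the vertical one,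
    starting with the last edge, which is the one next to the vertical walk. *)
Lemma product_walks_commute p s x u y r :
    path eA x u -> path eB y r ->
    is_walk e (p ++ map (f^~ y) (x :: u) ++ map (f (last x u)) r ++ s) ->
  walk_equiv e (p ++ map (f^~ y) (x :: u) ++ map (f (last x u)) r ++ s)
               (p ++ map (f x) (y :: r) ++ map (f^~ (last y r)) u ++ s).
Proof.
move=> Hu Hr; elim: u p x Hu => [|x' u IHu] p x /=.
  by move=> _; apply: walk_equiv_refl.
case/andP=> exx' Hu Hw.
have Hpush : walk_equiv e
    (p ++ f x y :: map (f^~ y) (x' :: u) ++ map (f (last x' u)) r ++ s)
    (p ++ f x y :: map (f x') (y :: r) ++ map (f^~ (last y r)) u ++ s).
  by move: Hw; rewrite -!(cat_rcons (f x y)); apply: IHu.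
apply: (walk_equiv_trans Hpush).
exact: slide_edge exx' Hr (walk_equiv_is_walk Hpush).
Qed.

End ProductWalks.

Section HammingPlane.

Variables (d q : nat) (hq : 0 < q).
Implicit Types (i j k : 'I_d) (a b : 'I_q).

Lemma hamming_off_axis i (u v : hamming_vertex d q) :
  (forall k, k != i -> u k = v k) -> hamming u v = (u i != v i).
Proof.
move=> Huv; rewrite /hamming.
have -> : [set k | u k != v k] = if u i != v i then [set i] else set0.
  apply/setP=> k; rewrite inE; case: (eqVneq k i) => [->|Hk].
    by case: ifP => Hi; rewrite ?inE ?eqxx.
  by rewrite Huv // eqxx; case: ifP => _; rewrite inE // (negPf Hk).
by case: (u i != v i); rewrite ?cards1 ?cards0.
Qed.

Definition plane_vertex i j a b : hamming_vertex d q :=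
  [ffun k => if k == i then a else if k == j then b else Ordinal hq].

Lemma hamming_plane_l i j a a' b :
  a != a' -> hamming (plane_vertex i j a b) (plane_vertex i j a' b).
Proof.
by move=> Ha; rewrite (@hamming_off_axis i) => [|k /negPf Hk];
   rewrite !ffunE ?eqxx ?Hk.
Qed.

Lemma hamming_plane_r i j a b b' :
  i != j -> b != b' -> hamming (plane_vertex i j a b) (plane_vertex i j a b').
Proof.
move=> Hij Hb.
rewrite (@hamming_off_axis j) => [|k /negPf Hk];
  last by rewrite !ffunE Hk.
by rewrite !ffunE eqxx [j == i]eq_sym (negPf Hij).
Qed.

Lemma plane_vertex_l i j a : plane_vertex i j a (Ordinal hq) = axis_vertex hq i a.
Proof. by apply/ffunP=> k; rewrite !ffunE if_same. Qed.

Lemma plane_vertex_r i j b :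
  i != j -> plane_vertex i j (Ordinal hq) b = axis_vertex hq j b.
Proof.
move=> Hij; apply/ffunP=> k; rewrite !ffunE.
by case: (eqVneq k i) => // ->; rewrite (negPf Hij).
Qed.

Lemma axis_vertex0 i : axis_vertex hq i (Ordinal hq) = origin d hq.
Proof. by apply/ffunP=> k; rewrite !ffunE if_same. Qed.

Lemma hamming_axis i a b :
  hamming (axis_vertex hq i a) (axis_vertex hq i b) = (a != b).
Proof.
by rewrite (@hamming_off_axis i) => [|k /negPf Hk]; rewrite !ffunE ?eqxx ?Hk.
Qed.

(** A ground walk is the image of a closed walk in the complete graph on the
    alphabet; this is the form in which it is a side of a rectangle. *)
Lemma ground_walkP i U :
    ground_walk hq i U ->
  exists2 u : seq 'I_q,
    path [rel a b | a != b] (Ordinal hq) u /\ last (Ordinal hq) u = Ordinal hq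
    & U = map (axis_vertex hq i) (Ordinal hq :: u).
Proof.
case=> Hw [a [b def_U]]; exists [:: a; b; Ordinal hq].
  by move: Hw; rewrite def_U -(axis_vertex0 i) /= !hamming_axis.
by rewrite def_U /= axis_vertex0.
Qed.

End HammingPlane.

Theorem lemma4p4 (d q : nat) (hd : 0 < d) (hq : 0 < q) (i j : 'I_d)
    (hij : i <> j) (Ui Uj : seq (hamming_vertex d q))
    (hUi : ground_walk hq i Ui) (hUj : ground_walk hq j Uj) :
  walk_equiv (@hamming d q) (walk_cat Ui Uj) (walk_cat Uj Ui).
Proof.
have nij : i != j by apply/eqP.
have [HwUi HwUj] := (proj1 hUi, proj1 hUj).
have [u [Hu lastu] def_Ui] := ground_walkP hUi.
have [r [Hr lastr] def_Uj] := ground_walkP hUj.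
pose o := Ordinal hq; pose f := plane_vertex hq i j.
have f_i : f^~ o =1 axis_vertex hq i by move=> a; apply: plane_vertex_l.
have f_j : f o =1 axis_vertex hq j by move=> b; apply: plane_vertex_r.
have Hcat : is_walk (@hamming d q) (walk_cat Ui Uj).
  move: HwUi HwUj; rewrite def_Ui def_Uj /walk_cat /= cat_path => -> /=.
  by rewrite last_map lastu !axis_vertex0.
have f_l a a' b : a != a' -> hamming (f a b) (f a' b).
  exact: hamming_plane_l.
have f_r a b b' : b != b' -> hamming (f a b) (f a b').
  exact: hamming_plane_r.
have := product_walks_commute f_l f_r (p := [::]) (s := [::]) Hu Hr.
rewrite lastu lastr !cats0 !cat0s !(eq_map f_i) !(eq_map f_j).
by move: Hcat; rewrite def_Ui def_Uj => Hcat; apply.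
Qed.
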